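(* Let $\Sigma^*$ be the optimal solution of $$\min_{\Sigma\succeq\epsilon I}\ \tfrac12\|\Sigma-S^l\|_F^2+\tfrac12\|\Sigma-S^u\|_F^2+\lambda\sum_{i\neq j}|\sigma_{ij}|,$$ where $S^l,S^u$ are the empirical covariance matrices of the lower-bound and upper-bound data, and let $\Sigma^0$ be the true covariance matrix. Let $\gamma>0$, $\tau>0$ and $K_4>0$ be such that the polynomial-tail condition $$\max\big\{\mathbb{E}|Y^l_{ij}|^{4(1+\gamma+\tau)},\ \mathbb{E}|Y^u_{ij}|^{4(1+\gamma+\tau)}\big\}\le K_4$$ holds for all $1\le i\le n$, $1\le j\le p$. Assume $p\le cn^\gamma$ for some $c>0$. For $M>0$, select $$\lambda=8(K_4+1)(M+1)\frac{\log p}{n}+8(K_4+1)(M+2)\Big(\frac{\log p}{n}\Big)^{1/2}.$$ Then, with probability at least $$1-O(p^{-M})-6K_4\,p\,(\log n)^{2(1+\gamma+\tau)}n^{-(\gamma+\tau)},$$ we have $$\|\Sigma^*-\Sigma^0\|_F\le5\lambda(\alpha+p)^{1/2}.$$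
   Context: Data: $n$ independent, identically distributed interval-valued observations $Y_i=(Y_{i1},\dots,Y_{ip})^\top$, $Y_{ij}=[Y^l_{ij},Y^u_{ij}]$. The lower-bound vector $(Y^l_{i1},\dots,Y^l_{ip})$ and upper-bound vector $(Y^u_{i1},\dots,Y^u_{ip})$ are assumed to have the same dependency structure, i.e. the same true covariance matrix $\Sigma^0=(\sigma^0_{ij})_{1\le i,j\le p}$, which is positive definite. $S^l=(s^l_{ij})$ and $S^u=(s^u_{ij})$ are the empirical covariance matrices, $s^l_{ij}=\frac1n\sum_{k=1}^nY^l_{ki}Y^l_{kj}-\big(\frac1n\sum_{k=1}^nY^l_{ki}\big)\big(\frac1n\sum_{k=1}^nY^l_{kj}\big)$, and similarly $s^u_{ij}$. $\epsilon>0$ is an arbitrarily small positive constant, in the sense that $\Sigma^0\succeq\epsilon I$; the minimization is over symmetric $p\times p$ matrices $\Sigma=(\sigma_{ij})$ with $\Sigma-\epsilon I$ positive semidefinite. $\|\cdot\|_F$ is the Frobenius norm. $\alpha=|\{(i,j):i\ne j,\ \sigma^0_{ij}\ne0\}|$. The constant implied by $O(p^{-M})$ does not depend on $n$ or $p$. *)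

(* Defs.v *)
From HB Require Import structures.
From mathcomp Require Import all_boot all_order all_algebra.
From mathcomp Require Import all_classical all_reals all_analysis.

Set Implicit Arguments.
Unset Strict Implicit.
Unset Printing Implicit Defensive.

Import Order.TTheory GRing.Theory Num.Theory.

Local Open Scope classical_set_scope.
Local Open Scope ring_scope.

Definition frobenius_norm (R : realType) (m n : nat) (A : 'M[R]_(m, n)) : R :=
  Num.sqrt (\sum_(i < m) \sum_(j < n) A i j ^+ 2).

Definition psd (R : realType) (p : nat) (A : 'M[R]_p) : Prop :=
  A^T = A /\ forall x : 'cV[R]_p, 0 <= (x^T *m A *m x) 0 0.

Definition loewner_ge (R : realType) (p : nat) (A B : 'M[R]_p) : Prop :=
  psd (A - B).

Definition empirical_cov (R : realType) (n p : nat) (y : 'I_n -> 'I_p -> R) :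
    'M[R]_p :=
  \matrix_(i, j) (n%:R^-1 * (\sum_(k < n) y k i * y k j)
    - (n%:R^-1 * \sum_(k < n) y k i) * (n%:R^-1 * \sum_(k < n) y k j)).

Definition objective (R : realType) (p : nat) (lambda : R)
    (Sl Su Sigma : 'M[R]_p) : R :=
  2^-1 * frobenius_norm (Sigma - Sl) ^+ 2
  + 2^-1 * frobenius_norm (Sigma - Su) ^+ 2
  + lambda * \sum_(i < p) \sum_(j < p | i != j) `|Sigma i j|.

Definition optimal_solution (R : realType) (p : nat) (eps lambda : R)
    (Sl Su Sigma : 'M[R]_p) : Prop :=
  loewner_ge Sigma eps%:M /\
  forall Sigma' : 'M[R]_p, loewner_ge Sigma' eps%:M ->
    objective lambda Sl Su Sigma <= objective lambda Sl Su Sigma'.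

Definition offdiag_support (R : realType) (p : nat) (A : 'M[R]_p) : nat :=
  #|[pred ij : 'I_p * 'I_p | (ij.1 != ij.2) && (A ij.1 ij.2 != 0)]|.

Section iid.
Context (d d' : measure_display) (T : measurableType d) (T' : measurableType d')
  (R : realType) (P : probability T R) (n : nat).
Implicit Type Y : 'I_n -> {RV P >-> T'}.

Definition mutually_independent Y : Prop :=
  forall (J : {set 'I_n}) (B : 'I_n -> set T'), (forall k, measurable (B k)) ->
    P (\bigcap_(k in [set k | k \in J]) (Y k @^-1` B k)) =
    (\prod_(k in J) P (Y k @^-1` B k))%E.

Definition identically_distributed Y : Prop :=
  forall (k k' : 'I_n) (B : set T'), measurable B ->
    distribution P (Y k) B = distribution P (Y k') B.

Definition iid Y : Prop := mutually_independent Y /\ identically_distributed Y.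

End iid.

(* A vector of p intervals is the p-tuple of the pairs of its endpoints, with
   the product (Borel) sigma-algebra of R^(2p). *)
Definition lower (R : realType) (p : nat) (y : p.-tuple (R * R)) (j : 'I_p) : R :=
  (tnth y j).1.

Definition upper (R : realType) (p : nat) (y : p.-tuple (R * R)) (j : 'I_p) : R :=
  (tnth y j).2.

(* Main.v *)
(* The quadratic part of the objective is |Sigma - Sbar|^2 up to a constant, where
   Sbar = (S^l + S^u) / 2.  If Sbar is within lambda / 2 of Sigma0 entrywise, then
   comparing the values of the objective at Sigma* and Sigma0 entry by entry
   yields |Sigma* - Sigma0|^2 <= 4 lambda^2 (alpha + p).

   Outside an event of probability at most 2 n p K4 delta^(-4(1+gamma+tau)), with
   delta = n^(1/4) / (log n)^(1/2), all observations are bounded by delta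
   (Markov's inequality).  On this event a Bernstein bound applies to the sums of
   products and to the sums of coordinates.  It has no truncation bias: for every
   real x, e^x 1_{x <= 1/4} <= 1 + x + 3 x^2 / 4, hence the truncated
   exponential moment is controlled by the untruncated first two moments.

   Sigma* is measurable because strong convexity makes the minimizer a Lipschitz
   function of the empirical covariance matrices. *)

Require Import Defs.
From HB Require Import structures.
From mathcomp Require Import all_boot all_order all_algebra.
From mathcomp Require Import all_classical all_reals all_analysis.
From mathcomp Require Import measurable_realfun ring lra.

Set Implicit Arguments.
Unset Strict Implicit.
Unset Printing Implicit Defensive.

Import Order.TTheory GRing.Theory Num.Theory.

Local Open Scope classical_set_scope.
Local Open Scope ring_scope.

(** * Penalized least squares *)

Section penalized_objective.
Context {R : realType} {p : nat}.
Implicit Types (A B Sl Su Sigma : 'M[R]_p) (lambda eps : R).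

Lemma frobenius_norm_sqr (m n : nat) (A : 'M[R]_(m, n)) :
  frobenius_norm A ^+ 2 = \sum_(i < m) \sum_(j < n) A i j ^+ 2.
Proof.
by rewrite sqr_sqrtr//; do 2 apply: sumr_ge0 => ? _; exact: sqr_ge0.
Qed.

(** The objective separates over the entries, so every optimality argument reduces to a scalar
    inequality. The Boolean marks the off-diagonal entries, where the penalty acts. *)
Definition entry_loss lambda (b : bool) (l u x : R) : R :=
  2^-1 * (x - l) ^+ 2 + 2^-1 * (x - u) ^+ 2 + (if b then lambda * `|x| else 0).

Lemma objectiveE lambda Sl Su Sigma :
  objective lambda Sl Su Sigma =
  \sum_(i < p) \sum_(j < p)
    entry_loss lambda (i != j) (Sl i j) (Su i j) (Sigma i j).
Proof.
rewrite /objective !frobenius_norm_sqr !mulr_sumr -!big_split/=.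
apply: eq_bigr => i _; rewrite !mulr_sumr (big_mkcond (fun j => i != j)).
by rewrite -!big_split/=; apply: eq_bigr => j _; rewrite !mxE.
Qed.

(** The midpoint case of convexity makes the average of two minimizers an admissible competitor in
    both of their problems. *)
Lemma loewner_ge_mid A B (C : 'M[R]_p) :
  loewner_ge A C -> loewner_ge B C -> loewner_ge (2^-1 *: (A + B)) C.
Proof.
move=> [symA geA] [symB geB]; rewrite /loewner_ge.
have -> : 2^-1 *: (A + B) - C = 2^-1 *: (A - C) + 2^-1 *: (B - C).
  by apply/matrixP => i j; rewrite !mxE; field.
split=> [|x]; first by rewrite linearD/= !linearZ/= symA symB.
rewrite mulmxDr mulmxDl -!scalemxAr -!scalemxAl.
have := geA x; have := geB x.
move: (_ *m (A - C) *m _) (_ *m (B - C) *m _) => a b b0 a0; rewrite !mxE; lra.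
Qed.

(* The entrywise form of the basic inequality; summed over the entries, it makes
   the Cauchy-Schwarz inequality unnecessary. *)
Lemma entry_loss_growth lambda (b : bool) (l u x s : R) :
  0 <= lambda -> `|2^-1 * (l + u) - s| <= 2^-1 * lambda ->
  2^-1 * (x - s) ^+ 2 - (2 * lambda ^+ 2) *+ (~~ b || (s != 0))
    <= entry_loss lambda b l u x - entry_loss lambda b l u s.
Proof.
move=> lambda0 lus; rewrite /entry_loss.
have : `|(x - s) * (2^-1 * (l + u) - s)| <= `|x - s| * (2^-1 * lambda).
  by rewrite normrM ler_wpM2l.
rewrite ler_norml => /andP[_ cross].
have xs2 : `|x - s| ^+ 2 = (x - s) ^+ 2 by rewrite real_normK// num_real.
(* The change of the penalty and the cross term together cost at most [2 * lambda] times |x - s|.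
   Half of this square trades that for half of [(x - s) ^+ 2] and the constant [2 * lambda ^+ 2]. *)
have amgm : 0 <= (`|x - s| - 2 * lambda) ^+ 2 by exact: sqr_ge0.
case: b => /=; last first.
  by rewrite mulr1n; nra.
(* At a penalized entry with [s = 0], the penalty on [x] pays for the whole cross term, so nothing
   is lost. *)
have [s0|s0] := eqVneq s 0; rewrite /= ?mulr0n ?mulr1n.
  by move: cross xs2 amgm; rewrite s0 normr0 !subr0 => *; nra.
have : `|s| - `|x| <= `|x - s| by rewrite distrC; exact: lerB_dist.
by move=> tri; have := ler_wpM2l lambda0 tri; nra.
Qed.

(** The parallelogram identity gives the quadratic gain, which is the strong convexity of the loss;
    the triangle inequality handles the penalty. *)
Lemma entry_loss_mid lambda (b : bool) (l u x y : R) : 0 <= lambda ->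
  entry_loss lambda b l u (2^-1 * (x + y)) <=
  2^-1 * (entry_loss lambda b l u x + entry_loss lambda b l u y)
    - 2^-1 * (2^-1 * (x - y) ^+ 2).
Proof.
move=> lambda0; rewrite /entry_loss.
case: b; last by lra.
have : `|2^-1 * (x + y)| <= 2^-1 * (`|x| + `|y|).
  by rewrite normrM gtr0_norm ?invr_gt0// ler_pM2l ?invr_gt0// ler_normD.
by move/(ler_wpM2l lambda0); lra.
Qed.

(** These are the entries where [entry_loss_growth] loses [2 * lambda ^+ 2]; the unpenalized
    diagonal accounts for the summand [p]. *)
Lemma card_offdiag_support A :
  (\sum_(i < p) \sum_(j < p) (~~ (i != j) || (A i j != 0%R)))%N =
  (offdiag_support A + p)%N.
Proof.
rewrite pair_big/=.
rewrite (eq_bigr (fun ij : 'I_p * 'I_p =>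
  (((ij.1 != ij.2) && (A ij.1 ij.2 != 0%R)) + (ij.1 == ij.2))%N)); last first.
  by move=> [i j] _ /=; case: (i == j); case: (A i j != 0%R).
rewrite big_split/=; congr addn.
  rewrite /offdiag_support -sum1_card [RHS]big_mkcond/=.
  by apply: eq_bigr => ij _; rewrite inE; case: ifP.
rewrite -(pair_bigA _ (fun i j : 'I_p => (i == j) : nat))/=.
rewrite (eq_bigr (fun=> 1%N)) ?sum1_card ?card_ord// => i _.
rewrite (bigD1 i)//= eqxx big1// => j ji.
by rewrite eq_sym (negPf ji).
Qed.

Lemma optimal_solution_error eps lambda Sl Su Sigma A :
    0 <= lambda -> optimal_solution eps lambda Sl Su Sigma ->
    loewner_ge A eps%:M ->
    (forall i j, `|2^-1 * (Sl i j + Su i j) - A i j| <= 2^-1 * lambda) ->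
  frobenius_norm (Sigma - A)
    <= 2 * lambda * Num.sqrt (offdiag_support A + p)%:R.
Proof.
move=> lambda0 [_ opt] Aeps close; have := opt _ Aeps.
rewrite !objectiveE -subr_le0 -sumrB => opt0.
have sqle : \sum_(i < p) \sum_(j < p) (Sigma - A) i j ^+ 2
    <= (2 * lambda) ^+ 2 * (offdiag_support A + p)%:R.
  rewrite -card_offdiag_support -subr_le0 natr_sum mulr_sumr -sumrB.
  suff : 2^-1 * \sum_(i < p) (\sum_(j < p) (Sigma - A) i j ^+ 2 -
      (2 * lambda) ^+ 2 * (\sum_(j < p) (~~ (i != j) || (A i j != 0%R)))%N%:R)
      <= 0 by rewrite pmulr_rle0// invr_gt0.
  apply: le_trans opt0; rewrite mulr_sumr; apply: ler_sum => i _.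
  rewrite natr_sum mulr_sumr -!sumrB mulr_sumr; apply: ler_sum => j _.
  apply: le_trans (entry_loss_growth (i != j) (Sigma i j) lambda0 (close i j)).
  rewrite !mxE; case: (~~ (i != j) || _); rewrite ?mulr1n ?mulr0n; lra.
rewrite /frobenius_norm (le_trans (ler_wsqrtr sqle))//.
by rewrite sqrtrM ?sqr_ge0// sqrtr_sqr ger0_norm// mulr_ge0.
Qed.

(** Both minimizers are compared with their midpoint. When the two inequalities are added, the
    penalties cancel, and only the strong convexity gain and a term bilinear in the differences of
    minimizers and data remain. *)
Lemma optimal_solution_lipschitz eps lambda Sl Su Sl' Su' Sigma Sigma' :
    0 <= lambda -> optimal_solution eps lambda Sl Su Sigma ->
    optimal_solution eps lambda Sl' Su' Sigma' ->
  \sum_(i < p) \sum_(j < p) (Sigma i j - Sigma' i j) ^+ 2 <=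
  \sum_(i < p) \sum_(j < p)
    (Sl i j + Su i j - (Sl' i j + Su' i j)) ^+ 2.
Proof.
move=> lambda0 [fe opt] [fe' opt'].
have feM := loewner_ge_mid fe fe'.
have := lerD (opt _ feM) (opt' _ feM).
rewrite !objectiveE -!big_split/= -subr_le0 -sumrB => opt0.
rewrite -subr_le0 -sumrB.
suff : 4^-1 * \sum_(i < p) (\sum_(j < p) (Sigma i j - Sigma' i j) ^+ 2 -
      (\sum_(j < p) (Sl i j + Su i j - (Sl' i j + Su' i j)) ^+ 2))
      <= 0 by rewrite pmulr_rle0// invr_gt0.
apply: le_trans opt0; rewrite mulr_sumr; apply: ler_sum => i _.
rewrite -!big_split/= -!sumrB mulr_sumr; apply: ler_sum => j _; rewrite !mxE.
have := entry_loss_mid (i != j) (Sl i j) (Su i j)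
  (Sigma i j) (Sigma' i j) lambda0.
have := entry_loss_mid (i != j) (Sl' i j) (Su' i j)
  (Sigma i j) (Sigma' i j) lambda0.
(* This square bounds the bilinear term by the two squared differences, half of each. *)
have : 0 <= (Sigma i j - Sigma' i j -
  (Sl i j + Su i j - (Sl' i j + Su' i j))) ^+ 2 by exact: sqr_ge0.
rewrite /entry_loss; case: (i != j); lra.
Qed.

End penalized_objective.

(** * Measurability of the minimizer *)

(* [{f > a}] is the union of the countably many rational boxes
   [{q i < S i < r i for all i}] that it contains. *)
Lemma measurable_fun_locally_controlled d (T : measurableType d) (R : realType)
    (K : finType) (S : K -> T -> R) (f : T -> R) :
    (forall i, measurable_fun setT (S i)) ->
    (forall w (e : R), 0 < e -> exists2 delta : R, 0 < delta &
      forall w', (forall i, `|S i w' - S i w| < delta) -> `|f w' - f w| < e) ->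
  measurable_fun setT f.
Proof.
move=> mS fS mT; apply: (measurability _ (RGenOInfty.measurableE R)) => //.
move=> /= _ [_ [a ->] <-]; rewrite preimage_itvoy setTI.
pose box (q : {ffun K -> rat * rat}) :=
  \bigcap_(i in [set: K]) [set w | ratr (q i).1 < S i w < ratr (q i).2].
(* The boxes are enumerated through [pickle]. A number that codes no box, or a box not contained in
   the superlevel set, contributes the empty set. *)
pose boxn n := if unpickle n is Some q
  then (if `[< box q `<=` [set x | a < f x] >] then box q else set0) else set0.
have mbox q : measurable (box q).
  apply: fin_bigcap_measurable => // i _.
  have -> : [set w | ratr (q i).1 < S i w < ratr (q i).2] =
      setT `&` S i @^-1` `]ratr (q i).1, ratr (q i).2[%classic.
    by rewrite setTI; apply/seteqP; split => w /=; rewrite in_itv.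
  by apply: mS => //; exact: measurable_itv.
have -> : [set x | a < f x] = \bigcup_n boxn n.
  apply/seteqP; split=> [w /= aw|w [n _]]; last first.
    by rewrite /boxn; case: unpickle => // q; case: asboolP => // qU /qU.
  have [delta delta0 ctl] := fS w (f w - a) (ltac:(by rewrite subr_gt0)).
  have rat_near i : {q : rat * rat |
      S i w - delta < ratr q.1 < S i w /\ S i w < ratr q.2 < S i w + delta}.
    have [q1 q1S] := cid (@rat_in_itvoo R (S i w - delta) (S i w) ltac:(lra)).
    have [q2 q2S] := cid (@rat_in_itvoo R (S i w) (S i w + delta) ltac:(lra)).
    by exists (q1, q2); move: q1S q2S; rewrite !in_itv.
  pose q := [ffun i => sval (rat_near i)].
  exists (pickle q) => //; rewrite /boxn pickleK.
  case: asboolP => [_ i _|]; first by rewrite /= ffunE; have := svalP (rat_near i); lra.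
  case=> w' bw' /=; suff : `|f w' - f w| < f w - a by rewrite ltr_norml; lra.
  apply: ctl => i; have := bw' i I; rewrite /= ffunE ltr_norml.
  by have := svalP (rat_near i); lra.
apply: bigcup_measurable => n _; rewrite /boxn.
by case: unpickle => // q; case: ifP.
Qed.

Section optimal_solution_measurable.
Context {d : measure_display} {T : measurableType d} {R : realType} {p : nat}.

Lemma measurable_optimal_solution (eps lambda : R) (Sl Su Sigma : T -> 'M[R]_p) :
    0 <= lambda ->
    (forall i j, measurable_fun setT (fun w => Sl w i j)) ->
    (forall i j, measurable_fun setT (fun w => Su w i j)) ->
    (forall w, optimal_solution eps lambda (Sl w) (Su w) (Sigma w)) ->
  forall i j, measurable_fun setT (fun w => Sigma w i j).
Proof.
move=> lambda0 mSl mSu opt i j.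
(* The Lipschitz bound depends on the data only through the entries of the sum of the two covariance
   matrices. *)
pose S (ij : 'I_p * 'I_p) w := Sl w ij.1 ij.2 + Su w ij.1 ij.2.
apply: (@measurable_fun_locally_controlled _ _ _ _ S).
  by move=> ij; exact: measurable_funD.
move=> w e e0; have p0 : 0 < p%:R :> R by rewrite ltr0n; case: {+}p i => [[]|].
(* With this radius the [p ^ 2] squared differences of the data add up to less than [e ^+ 2]. *)
exists (e / p%:R) => [|w' ctl]; first by rewrite divr_gt0.
rewrite -[ltRHS]ger0_norm ?ltW// -ltr_sqr ?nnegrE//.
rewrite !real_normK ?num_real//.
have /le_lt_trans := optimal_solution_lipschitz lambda0 (opt w') (opt w).
have entry_le : (Sigma w' i j - Sigma w i j) ^+ 2 <=
    \sum_(i < p) \sum_(j < p) (Sigma w' i j - Sigma w i j) ^+ 2.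
  rewrite (bigD1 i)//= (bigD1 j)//= -!addrA lerDl addr_ge0//.
    by apply: sumr_ge0 => ? _; exact: sqr_ge0.
  by do 2 apply: sumr_ge0 => ? _; exact: sqr_ge0.
move=> lip; apply: (le_lt_trans entry_le); apply: lip.
have -> : e ^+ 2 = \sum_(i < p) \sum_(j < p) (e / p%:R) ^+ 2.
  by rewrite !sumr_const !card_ord -mulrnA -[RHS]mulr_natr natrM; field; rewrite gt_eqF.
rewrite [ltLHS]pair_big [ltRHS]pair_big; apply: ltr_sum.
  by apply/hasP; exists (i, j); rewrite ?mem_index_enum.
move=> ij _.
rewrite -(real_normK (num_real _)) ltr_pXn2r ?nnegrE ?normr_ge0//.
  exact: ctl ij.
by rewrite divr_ge0// ltW.
Qed.

Lemma measurable_empirical_cov (n : nat) (y : T -> 'I_n -> 'I_p -> R) :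
    (forall k j, measurable_fun setT (fun w => y w k j)) ->
  forall i j, measurable_fun setT (fun w => empirical_cov (y w) i j).
Proof.
move=> my i j; rewrite (_ : (fun w => _) = (fun w =>
    n%:R^-1 * (\sum_(k < n) y w k i * y w k j)
    - (n%:R^-1 * \sum_(k < n) y w k i) * (n%:R^-1 * \sum_(k < n) y w k j))).
  by apply: measurable_funB; repeat (apply: measurable_funM => //);
    apply: measurable_sum => // k; exact: measurable_funM.
by apply/funext => w; rewrite mxE.
Qed.

Lemma measurable_frobenius_norm (m n : nat) (A : T -> 'M[R]_(m, n)) :
    (forall i j, measurable_fun setT (fun w => A w i j)) ->
  measurable_fun setT (fun w => frobenius_norm (A w)).
Proof.
move=> mA; apply: (measurableT_comp (f := @Num.sqrt R)).
  by apply: continuous_measurable_fun => x; exact: sqrt_continuous.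
do 2 apply: measurable_sum => ?; exact: measurable_funX.
Qed.

End optimal_solution_measurable.

(** * Expectation of a product of independent variables *)

Section product_expectation.
Local Open Scope ereal_scope.
Context {d d' : measure_display} {T : measurableType d}
  {T' : measurableType d'} {R : realType} {P : probability T R}.

Import HBNNSimple.

(** The simple-function stage of the extension from indicators. The value is left as a sum over the
    range of [h], so that the choice [D = 1], [c = 1] evaluates the plain integral of [h] in the
    same form. *)
Lemma ge0_integral_mul_nnsfun_comp (X : {RV P >-> T'}) (D : T -> R)
    (c : \bar R) (h : {nnsfun T' >-> R}) :
    measurable_fun setT (EFin \o D) -> (forall w, 0 <= D w)%R ->
    (forall B, measurable B ->
      \int[P]_w ((D w)%:E * (\1_B (X w))%:E) = c * P (X @^-1` B)) ->
  \int[P]_w ((D w)%:E * (h (X w))%:E) =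
  \sum_(r \in range h) (r%:E * (c * P (X @^-1` (h @^-1` [set r])))).
Proof.
move=> mD D0 DX.
have mX (B : set T') : measurable B ->
    measurable_fun setT (fun w => (\1_B (X w) : R)%:E).
  move=> mB; apply/measurable_EFinP.
  by apply: (@measurableT_comp _ _ _ _ _ _ (\1_B : T' -> R) _ X).
transitivity (\int[P]_w \sum_(r \in range h)
    ((D w)%:E * (r * \1_(h @^-1` [set r]) (X w))%:E)).
  apply: eq_integral => w _; rewrite fimfunE -fsumEFin// ge0_mule_fsumr//.
  by move=> r; rewrite (EFinM r) nnfun_muleindic_ge0.
rewrite (@ge0_integral_fsum _ _ _ P _ measurableT _
  (fun r w => (D w)%:E * (r * \1_(h @^-1` [set r]) (X w))%:E))//; last 2 first.
  - move=> r; apply: emeasurable_funM => //; apply/measurable_EFinP.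
    by apply: measurable_funM => //; exact/measurable_EFinP/mX.
  - move=> r w _; apply: mule_ge0; first by rewrite lee_fin.
    by rewrite (EFinM r) nnfun_muleindic_ge0.
apply: eq_fsbigr => r /set_mem[y _ hyr].
rewrite -DX// -ge0_integralZl//.
- by apply: eq_integral => w _; rewrite (EFinM r) muleCA.
- by apply: emeasurable_funM => //; exact: mX.
- by move=> w _; rewrite mule_ge0// lee_fin.
- by rewrite -hyr lee_fin.
Qed.

(** Monotone convergence along simple approximations extends the factorization from indicators of
    [X] to nonnegative functions of [X]. *)
Lemma ge0_integral_mul_comp (X : {RV P >-> T'}) (D : T -> R) (c : R) :
    measurable_fun setT (EFin \o D) -> (forall w, 0 <= D w)%R -> (0 <= c)%R ->
    (forall B, measurable B ->
      \int[P]_w ((D w)%:E * (\1_B (X w))%:E) = c%:E * P (X @^-1` B)) ->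
  forall g : T' -> \bar R, measurable_fun setT g -> (forall y, 0 <= g y) ->
  \int[P]_w ((D w)%:E * g (X w)) = c%:E * \int[P]_w g (X w).
Proof.
move=> mD D0 c0 DX g mg g0; pose h := nnsfun_approx measurableT mg.
have mhX n : measurable_fun setT (fun w => (h n (X w))%:E).
  by apply/measurable_EFinP; by apply: (@measurableT_comp _ _ _ _ _ _ (h n) _ X).
have mDh n : measurable_fun setT (fun w => (D w)%:E * (h n (X w))%:E).
  exact: emeasurable_funM.
have nd_h w : {homo (fun n => (h n (X w))%:E) : m n / (m <= n)%N >-> m <= n}.
  by move=> m n mn; rewrite lee_fin; exact/lefP/nd_nnsfun_approx.
have cvg_h w : (fun n => (h n (X w))%:E) @ \oo --> g (X w).
  exact: cvg_nnsfun_approx.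
transitivity (limn (fun n => \int[P]_w ((D w)%:E * (h n (X w))%:E))).
  rewrite -monotone_convergence//=.
  - apply: eq_integral => w _; apply/esym; apply: cvg_lim => //.
    exact: cvgeZl.
  - by move=> n w _; rewrite mule_ge0// lee_fin.
  - by move=> w _ m n mn; apply: lee_wpmul2l; [rewrite lee_fin|exact: nd_h].
have -> : \int[P]_w g (X w) = limn (fun n => \int[P]_w (h n (X w))%:E).
  rewrite -monotone_convergence//=.
  - by apply: eq_integral => w _; apply/esym/cvg_lim.
  - by move=> n w _; rewrite lee_fin.
rewrite -limeMl//; last first.
  apply: ereal_nondecreasing_is_cvgn => m n mn; apply: ge0_le_integral => //.
  - by move=> w _; rewrite lee_fin.
  - by move=> w _; exact: nd_h.
congr (limn _); apply/funext => n /=.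
rewrite (ge0_integral_mul_nnsfun_comp (h n) mD D0 DX).
have -> : \int[P]_w (h n (X w))%:E =
    \int[P]_w ((cst 1%R w)%:E * (h n (X w))%:E).
  by apply: eq_integral => w _; rewrite mul1e.
rewrite (@ge0_integral_mul_nnsfun_comp _ (cst 1%R) 1)//; last 2 first.
- exact/measurable_EFinP.
- move=> B mB; rewrite mul1e -[X in P X]setIT -integral_indic//.
    by apply: eq_integral => w _; rewrite mul1e.
  by exact: measurable_funPTI.
rewrite ge0_mule_fsumr; last first.
  by move=> r; rewrite mul1e; exact: (nnsfun_mulemu_ge0 (distribution P X)).
by apply: eq_fsbigr => r _; rewrite mul1e muleCA.
Qed.

(* Independence is the case [m = 0]; each step of the induction on [m] turns one
   more indicator into an arbitrary nonnegative function. *)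
Lemma expectation_prod_comp_indic_prefix n (Y : 'I_n -> {RV P >-> T'})
    (m : nat) (g : 'I_n -> T' -> R) :
    mutually_independent Y ->
    (forall k, measurable_fun setT (g k)) -> (forall k y, (0 <= g k y)%R) ->
    (forall k, \int[P]_w (g k (Y k w))%:E \is a fin_num) ->
    (forall k : 'I_n, (m <= k)%N -> exists2 B, measurable B & g k = \1_B) ->
  \int[P]_w (\prod_(k < n) g k (Y k w))%:E =
  \prod_(k < n) \int[P]_w (g k (Y k w))%:E.
Proof.
move=> indY; elim: m g => [|m IHm] g mg g0 gfin gind.
  have [B mB gB] : exists2 B : 'I_n -> set T',
      (forall k, measurable (B k)) & (forall k, g k = \1_(B k)).
    have /choice[B HB] : forall k, exists B, measurable B /\ g k = \1_B.
      by move=> k; have [B] := gind k isT; exists B.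
    by exists B => k; case: (HB k).
  have mYB k : measurable (Y k @^-1` B k).
    by exact: measurable_funPTI.
  (* The product of the indicators is the indicator of an intersection, to which independence
     applies with the full index set. *)
  transitivity (P (\bigcap_(k in [set k | k \in [set: 'I_n]%SET])
      (Y k @^-1` B k))).
    rewrite -[X in P X]setIT -integral_indic//; last first.
      by apply: fin_bigcap_measurable => // k _.
    apply: eq_integral => w _; congr EFin.
    rewrite indicE; have [wB|wB] := boolP (w \in _).
      rewrite big1// => k _; rewrite gB indicE mem_set//.
      by apply: (set_mem wB k); rewrite /= inE.
    have [k YB] : exists k, ~ B k (Y k w).
      apply/not_existsP => YB; move/negP: wB; apply; apply/mem_set => k _.
      exact: contrapT (YB k).
    by rewrite (bigD1 k)//= gB indicE memNset// mul0r.
  rewrite (indY _ _ mB); under eq_bigl do rewrite inE.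
  apply: eq_bigr => k _; rewrite -[X in P X]setIT -integral_indic//.
  by apply: eq_integral => w _; rewrite gB.
(* If [n <= m], the condition on the remaining factors is vacuous and the induction hypothesis
   already applies. Otherwise the factor of index [m] is the one to be generalized. *)
have [mn|nm] := ltnP m n; last first.
  apply: IHm => // k mk; have := ltn_ord k.
  by rewrite ltnNge (leq_trans nm mk).
pose k0 := Ordinal mn.
pose D w := (\prod_(k < n | k != k0) g k (Y k w))%R.
pose c := \prod_(k < n | k != k0) \int[P]_w (g k (Y k w))%:E.
have mgY k : measurable_fun setT (fun w => g k (Y k w)).
  by apply: (@measurableT_comp _ _ _ _ _ _ (g k) _ (Y k)).
have cfin : c \is a fin_num by apply: prode_fin_num.
have c0 : 0 <= c.
  by apply: prode_ge0 => k _; apply: integral_ge0 => w _; rewrite lee_fin.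
have -> : \prod_(k < n) \int[P]_w (g k (Y k w))%:E =
    (fine c)%:E * \int[P]_w (g k0 (Y k0 w))%:E.
  by rewrite (bigD1 k0)//= muleC fineK.
have -> : \int[P]_w (\prod_(k < n) g k (Y k w))%:E =
    \int[P]_w ((D w)%:E * (g k0 (Y k0 w))%:E).
  by apply: eq_integral => w _; rewrite (bigD1 k0)//= mulrC EFinM.
apply: (@ge0_integral_mul_comp (Y k0) D (fine c) _ _ _ _ (EFin \o g k0)) => //.
- apply/measurable_EFinP.
  have -> : D = (fun w => \prod_(k < n)
      (if k != k0 then g k (Y k w) else 1))%R.
    by apply/funext => w; rewrite /D big_mkcond.
  by apply: measurable_prod => k _; case: (k != k0).
- by move=> w; apply: prodr_ge0.
- exact: fine_ge0.
(* With an indicator in position [k0], the induction hypothesis gives exactly the factorization that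
   [ge0_integral_mul_comp] asks for. *)
- move=> B mB; pose g' k := if k == k0 then \1_B else g k.
  have := IHm g'; rewrite /g'.
  have -> : \int[P]_w (\prod_(k < n) (if k == k0 then \1_B else g k) (Y k w))%:E =
      \int[P]_w ((D w)%:E * (\1_B (Y k0 w))%:E).
    apply: eq_integral => w _; rewrite (bigD1 k0)//= eqxx mulrC EFinM.
    by congr (_%:E * _); apply: eq_bigr => k /negPf ->.
  have intB : \int[P]_w (\1_B (Y k0 w))%:E = P (Y k0 @^-1` B).
    rewrite -[X in P X]setIT -integral_indic//.
    by exact: measurable_funPTI.
  have -> : \prod_(k < n)
      \int[P]_w ((if k == k0 then \1_B else g k) (Y k w))%:E =
      (fine c)%:E * P (Y k0 @^-1` B).
    rewrite (bigD1 k0)//= eqxx intB muleC fineK//; congr (_ * _).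
    by apply: eq_bigr => k /negPf ->.
  apply => [k|k y|k|k mk]; have [kk0|kk0] := eqVneq k k0 => //.
  + by rewrite kk0 intB fin_num_measure//; exact: measurable_funPTI.
  + by exists B.
  + apply: gind; rewrite ltn_neqAle mk andbT.
    by apply: contra kk0 => /eqP mk'; apply/eqP/val_inj.
- exact/measurable_EFinP.
- by move=> y; rewrite lee_fin.
Qed.

Lemma expectation_prod_comp n (Y : 'I_n -> {RV P >-> T'}) (g : 'I_n -> T' -> R) :
    mutually_independent Y ->
    (forall k, measurable_fun setT (g k)) -> (forall k y, (0 <= g k y)%R) ->
    (forall k, \int[P]_w (g k (Y k w))%:E \is a fin_num) ->
  \int[P]_w (\prod_(k < n) g k (Y k w))%:E =
  \prod_(k < n) \int[P]_w (g k (Y k w))%:E.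
Proof.
move=> indY mg g0 gfin.
apply: (@expectation_prod_comp_indic_prefix _ _ n) => // k.
by rewrite leqNgt ltn_ord.
Qed.

End product_expectation.

(** * Bernstein's inequality under truncation *)

(* [expR x = expR (- x / 4) ^- 4 <= (1 - x / 4) ^- 4], and the latter is at most
   the quadratic because the difference of the cleared products is [x ^+ 2]
   times a polynomial that is positive for [x <= 1 / 4]. *)
Lemma expR_le_quadratic (R : realType) (x : R) : x <= 1 / 4 ->
  expR x <= 1 + x + 3 / 4 * x ^+ 2.
Proof.
move=> x14.
have exp0 : 0 < expR (- (x / 4)) by exact: expR_gt0.
have lin : 1 - x / 4 <= expR (- (x / 4)) by exact: expR_ge1Dx.
have lin0 : 0 <= 1 - x / 4 by lra.
have -> : expR x = (expR (- (x / 4)) ^+ 4)^-1.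
  by rewrite -expRM_natl -expRN; congr expR; rewrite mulrnAl; field.
rewrite -[leLHS]mul1r ler_pdivrMr ?exprn_gt0//.
have Q0 : 0 <= 1 + x + 3 / 4 * x ^+ 2 by nra.
apply: (@le_trans _ _ ((1 + x + 3 / 4 * x ^+ 2) * (1 - x / 4) ^+ 4)); last first.
  by rewrite ler_wpM2l// ler_pXn2r ?nnegrE// ltW.
rewrite -subr_ge0.
pose a := 1 / 8 - 7 / 16 * x; pose b := 57 / 256 - 11 / 256 * x.
pose c : R := 3 / 1024.
have -> : (1 + x + 3 / 4 * x ^+ 2) * (1 - x / 4) ^+ 4 - 1 =
    x ^+ 2 * (a + x ^+ 2 * b + c * (x ^+ 2) ^+ 2) by rewrite /a /b /c; field.
have a0 : 0 <= a by rewrite /a; lra.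
have b0 : 0 <= b by rewrite /b; lra.
have c0 : 0 <= c by rewrite /c; lra.
clearbody a b c; have x2 : 0 <= x ^+ 2 by exact: sqr_ge0.
apply: mulr_ge0 => //; apply: addr_ge0; first by rewrite addr_ge0// mulr_ge0.
by rewrite mulr_ge0// sqr_ge0.
Qed.

Section truncated_bernstein.
Context {d d' : measure_display} {T : measurableType d}
  {T' : measurableType d'} {R : realType} {P : probability T R}.

Lemma expectation_quadratic (X : T -> R) (a b : R) :
    X \in Lfun P 1 -> (fun w => X w ^+ 2) \in Lfun P 1 ->
  ('E_P[fun w => (1 + a * X w + b * X w ^+ 2)%R] =
  1 + a%:E * 'E_P[X] + b%:E * 'E_P[fun w => (X w ^+ 2)%R])%E.
Proof.
move=> L1X L1X2.
have -> : (fun w => 1 + a * X w + b * X w ^+ 2) =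
    (cst 1 \+ a \o* X) \+ b \o* (fun w => X w ^+ 2).
  by apply/funext => w /=; rewrite mulrC (mulrC b).
rewrite !expectationD ?rpredD ?Lfun_scale ?Lfun_cst//.
by rewrite expectation_cst !expectationZl.
Qed.

(** Truncation is a condition on the outcome and leaves the variables unchanged, so the sum is not
    recentred. The level [1 / 4] is the range of validity of [expR_le_quadratic]. *)
Definition truncated_excess n (Y : 'I_n -> {RV P >-> T'}) (g : T' -> R)
    (theta s : R) : set T :=
  [set w | (forall k, theta * g (Y k w) <= 1 / 4) /\
           s <= \sum_(k < n) g (Y k w)].

Lemma measurable_truncated_excess n (Y : 'I_n -> {RV P >-> T'}) (g : T' -> R)
    (theta s : R) :
  measurable_fun setT g -> measurable (truncated_excess Y g theta s).
Proof.
move=> mg; have mgY k : measurable_fun setT (fun w => g (Y k w)).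
  by apply: (@measurableT_comp _ _ _ _ _ _ g _ (Y k)).
have -> : truncated_excess Y g theta s = (\bigcap_(k in [set: 'I_n])
      [set w | theta * g (Y k w) <= 1 / 4])
    `&` [set w | s <= \sum_(k < n) g (Y k w)].
  apply/seteqP; split=> w /= [Aw sw]; split=> //.
    by move=> k _; exact: Aw.
  by move=> k; exact: (Aw k I).
have mle (f1 f2 : T -> R) : measurable_fun setT f1 -> measurable_fun setT f2 ->
    measurable [set w | f1 w <= f2 w].
  move=> m1 m2; have := measurable_fun_ler m1 m2.
  by move=> /(_ measurableT [set true]); rewrite setTI; exact.
apply: measurableI; last by apply: mle => //; exact: measurable_sum.
by apply: fin_bigcap_measurable => // k _; apply: mle => //; exact: measurable_funM.
Qed.

(* The truncated factor [h] lies below the quadratic for all values of [g], so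
   its expectation only involves the untruncated moments of [g]. *)
Lemma truncated_bernstein n (Y : 'I_n -> {RV P >-> T'}) (g : T' -> R)
    (m v t : R) :
    mutually_independent Y -> measurable_fun setT g -> 0 < v -> 0 <= t ->
    (forall k, (fun w => g (Y k w)) \in Lfun P 1) ->
    (forall k, 'E_P[fun w => g (Y k w)] = m%:E)%E ->
    (forall k, 'E_P[fun w => (g (Y k w) ^+ 2)%R] <= v%:E)%E ->
  (P (truncated_excess Y g (2 * t / (3 * v)) (n%:R * (m + t))) <=
    (expR (- (n%:R * t ^+ 2 / (3 * v))))%:E)%E.
Proof.
(* This [theta] minimizes [3 / 4 * theta ^+ 2 * v - theta * t], and the minimum is
   [- t ^+ 2 / (3 * v)]. *)
move=> indY mg v0 t0 L1 Em Ev; set theta := 2 * t / (3 * v).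
have theta0 : 0 <= theta by rewrite divr_ge0// mulr_ge0// ltW.
pose h y := if theta * g y <= 1 / 4 then expR (theta * g y) else 0.
have mtg : measurable_fun setT (fun y => theta * g y) by exact: measurable_funM.
have mh : measurable_fun setT h.
  apply: measurable_fun_ifT => //; first exact: measurable_fun_ler.
  exact: measurableT_comp.
have h0 y : 0 <= h y by rewrite /h; case: ifP => // _; exact: expR_ge0.
have quad0 y : 0 <= 1 + theta * g y + 3 / 4 * theta ^+ 2 * g y ^+ 2 by nra.
have hle y : h y <= 1 + theta * g y + 3 / 4 * theta ^+ 2 * g y ^+ 2.
  rewrite /h; case: ifPn => // /expR_le_quadratic /le_trans; apply.
  by rewrite exprMn mulrA.
have mgY k : measurable_fun setT (fun w => g (Y k w)).
  by apply: (@measurableT_comp _ _ _ _ _ _ g _ (Y k)).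
have mhY k : measurable_fun setT (fun w => h (Y k w)).
  by apply: (@measurableT_comp _ _ _ _ _ _ h _ (Y k)).
have L1sq k : (fun w => g (Y k w) ^+ 2) \in Lfun P 1.
  apply/Lfun1_integrable/integrableP; split.
    by apply/measurable_EFinP; exact: measurable_funX.
  apply: le_lt_trans (ltry v); apply: le_trans (Ev k).
  rewrite unlock; apply: ge0_le_integral => //.
  - by apply/measurable_EFinP; apply: measurableT_comp => //;
      exact: measurable_funX.
  - by apply/measurable_EFinP; exact: measurable_funX.
  - by move=> w _ /=; rewrite ger0_norm ?sqr_ge0.
have Eh k : (\int[P]_w (h (Y k w))%:E <=
    (expR (theta * m + 3 / 4 * theta ^+ 2 * v))%:E)%E.
  apply: (@le_trans _ _ 'E_P[fun w =>
      (1 + theta * g (Y k w) + (3 / 4 * theta ^+ 2) * g (Y k w) ^+ 2)%R])%E.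
    rewrite unlock; apply: ge0_le_integral => //.
    - by move=> w _; rewrite lee_fin.
    - exact/measurable_EFinP.
    - apply/measurable_EFinP; apply: measurable_funD.
        by apply: measurable_funD => //; exact: measurable_funM.
      by apply: measurable_funM => //; exact: measurable_funX.
    - by move=> w _; rewrite lee_fin.
  rewrite expectation_quadratic// Em.
  apply: (@le_trans _ _ (1 + theta * m + 3 / 4 * theta ^+ 2 * v)%:E).
    rewrite !EFinD [in leRHS]EFinM; apply: leeD; first by rewrite EFinM.
    by rewrite [in leRHS]EFinM lee_wpmul2l// lee_fin mulr_ge0// sqr_ge0.
  by rewrite lee_fin -addrA; exact: expR_ge1Dx.
set A := truncated_excess _ _ _ _.
have mA : measurable A by exact: measurable_truncated_excess.
pose c := expR (theta * (n%:R * (m + t))).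
(* Exponential Markov inequality: on [A] each factor [h] is a genuine exponential, and off [A] it
   suffices that the product is nonnegative. *)
have markov : (c%:E * P A <= \int[P]_w (\prod_(k < n) h (Y k w))%:E)%E.
  rewrite -[in leLHS](setIT A) -integral_indic// -ge0_integralZl//; last 2 first.
  - exact/measurable_EFinP.
  - by rewrite lee_fin expR_ge0.
  apply: ge0_le_integral => //.
  - by move=> w _; rewrite mule_ge0// lee_fin expR_ge0.
  - by apply/measurable_EFinP; exact: measurable_funM.
  - by apply/measurable_EFinP; exact: measurable_prod.
  - move=> w _; rewrite -EFinM lee_fin indicE.
    have [/set_mem[Aw sw]|_] := boolP (w \in A); last first.
      by rewrite mulr0; apply: prodr_ge0.
    rewrite mulr1 (eq_bigr (fun k => expR (theta * g (Y k w)))); last first.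
      by move=> k _; rewrite /h Aw.
    by rewrite -expR_sum ler_expR -mulr_sumr ler_wpM2l.
have prod_le : (\int[P]_w (\prod_(k < n) h (Y k w))%:E <=
    (expR (theta * m + 3 / 4 * theta ^+ 2 * v) ^+ n)%:E)%E.
  rewrite (@expectation_prod_comp _ _ _ _ _ _ _ _ (fun=> h))//; last first.
    move=> k; rewrite ge0_fin_numE; first exact: le_lt_trans (Eh k) (ltry _).
    by apply: integral_ge0 => w _; rewrite lee_fin.
  have -> : (expR (theta * m + 3 / 4 * theta ^+ 2 * v) ^+ n)%:E =
      (\prod_(k < n) (expR (theta * m + 3 / 4 * theta ^+ 2 * v))%:E)%E.
    by rewrite prodEFin prodr_const card_ord.
  have : ((0 <= \prod_(k < n) \int[P]_w (h (Y k w))%:E)%E /\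
    (\prod_(k < n) \int[P]_w (h (Y k w))%:E <=
      \prod_(k < n) (expR (theta * m + 3 / 4 * theta ^+ 2 * v))%:E))%E.
    apply: (big_ind2 (fun x y => (0 <= x /\ x <= y)%E)) => //.
    - by move=> x1 x2 y1 y2 [? ?] [? ?]; split; [exact: mule_ge0|exact: lee_pmul].
    - by move=> k _; split=> //; apply: integral_ge0 => w _; rewrite lee_fin.
  by case.
have := le_trans markov prod_le.
rewrite -lee_pdivlMl ?expR_gt0// => /le_trans; apply.
rewrite -EFinM lee_fin /c -expRN -expRM_natl -expRD ler_expR /theta.
rewrite le_eqVlt; apply/orP; left; apply/eqP.
by rewrite -mulr_natr; field; rewrite gt_eqF.
Qed.

End truncated_bernstein.

(** * Moments *)

Section moments.
Context {d : measure_display} {T : measurableType d} {R : realType}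
  {P : probability T R}.
Implicit Types X Z : T -> R.

(** The moment comparisons below rest on pointwise inequalities of this shape, which stand in for
    the Hölder and Cauchy-Schwarz inequalities. When one dominating variable suffices, [b2] is 0. *)
Lemma expectation_le_affine X Z1 Z2 (a b1 b2 c1 c2 : R) :
    measurable_fun setT X -> measurable_fun setT Z1 -> measurable_fun setT Z2 ->
    (forall w, 0 <= X w) -> (forall w, 0 <= Z1 w) -> (forall w, 0 <= Z2 w) ->
    0 <= a -> 0 <= b1 -> 0 <= b2 ->
    (forall w, X w <= a + b1 * Z1 w + b2 * Z2 w) ->
    ('E_P[Z1] <= c1%:E)%E -> ('E_P[Z2] <= c2%:E)%E ->
  ('E_P[X] <= (a + b1 * c1 + b2 * c2)%:E)%E.
Proof.
move=> mX mZ1 mZ2 X0 Z10 Z20 a0 b10 b20 XZ E1 E2.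
apply: (@le_trans _ _ (\int[P]_w (a%:E + b1%:E * (Z1 w)%:E + b2%:E * (Z2 w)%:E))%E).
  rewrite unlock; apply: ge0_le_integral => //.
  - by move=> w _; rewrite lee_fin.
  - exact/measurable_EFinP.
  - apply/measurable_EFinP; apply: measurable_funD; last exact: measurable_funM.
    by apply: measurable_funD => //; exact: measurable_funM.
  - by move=> w _; rewrite -!EFinM -!EFinD lee_fin.
have mbZ b Z : measurable_fun setT Z ->
    measurable_fun setT (fun w => b%:E * (Z w)%:E)%E.
  by move=> mZ; apply/measurable_EFinP; exact: measurable_funM.
rewrite !ge0_integralD//; do ?[exact: mbZ
  | by apply: emeasurable_funD => //; exact: mbZ
  | by move=> w _; rewrite ?adde_ge0 ?mule_ge0 ?lee_fin].
rewrite integral_cst//= probability_setT mule1 !ge0_integralZl//;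
  do ?[exact/measurable_EFinP | by move=> w _; rewrite lee_fin].
rewrite !EFinD !EFinM; move: E1 E2; rewrite unlock => E1 E2.
by rewrite leeD ?leeD// lee_wpmul2l ?lee_fin.
Qed.

Lemma dominated_Lfun1 X Z (c : R) :
    measurable_fun setT X -> measurable_fun setT Z ->
    (forall w, `|X w| <= Z w) -> ('E_P[Z] <= c%:E)%E ->
  X \in Lfun P 1.
Proof.
move=> mX mZ XZ EZ; apply/Lfun1_integrable/integrableP; split.
  exact/measurable_EFinP.
apply: le_lt_trans (ltry c); apply: le_trans EZ; rewrite unlock.
apply: ge0_le_integral => //.
- by apply: measurableT_comp => //; exact/measurable_EFinP.
- exact/measurable_EFinP.
- by move=> w _ /=; rewrite lee_fin.
Qed.

(** Splitting at |x| = 1 costs an additive 1, the source of the constant [K4 + 1] in [lambda]. *)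
Lemma expr4_le_powR (x q : R) : 4 <= q -> x ^+ 4 <= 1 + `|x| `^ q.
Proof.
move=> q4; have -> : x ^+ 4 = `|x| ^+ 4.
  by rewrite -normrX ger0_norm// exprn_even_ge0.
have [x1|x1] := leP `|x| 1.
  by rewrite (@le_trans _ _ 1) ?exprn_ile1// lerDl powR_ge0.
rewrite -powR_mulrn// (le_trans (ler_powR (ltW x1) q4))//.
by rewrite lerDr.
Qed.

Section fourth_moment.
Variables (A : R) (A1 : 1 <= A).

Let A0 : 0 < A. Proof. exact: lt_le_trans ltr01 A1. Qed.

Lemma expectation_sqr_le X : measurable_fun setT X ->
    ('E_P[fun w => (X w ^+ 4)%R] <= A%:E)%E ->
  ('E_P[fun w => (X w ^+ 2)%R] <= (Num.sqrt A)%:E)%E.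
Proof.
move=> mX E4; set V := Num.sqrt A.
have V0 : 0 < V by rewrite sqrtr_gt0.
have VV : V ^+ 2 = A by rewrite sqr_sqrtr// ltW.
(* The weight in Young's inequality is chosen so that each half contributes [V / 2], which recovers
   the bound of Jensen's inequality. *)
have -> : V = V / 2 + (2 * V)^-1 * A + 0 * A by rewrite -VV; field; rewrite gt_eqF.
apply: (@expectation_le_affine _ (fun w => X w ^+ 4) (fun w => X w ^+ 4)) => //;
  do ?[exact: measurable_funX].
- by move=> w; rewrite sqr_ge0.
- by move=> w; rewrite exprn_even_ge0.
- by move=> w; rewrite exprn_even_ge0.
- lra.
- by rewrite invr_ge0; lra.
- move=> w; rewrite mul0r addr0 -subr_ge0.
  have -> : V / 2 + (2 * V)^-1 * X w ^+ 4 - X w ^+ 2 =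
      (2 * V)^-1 * (X w ^+ 2 - V) ^+ 2 by field; rewrite gt_eqF.
  by rewrite mulr_ge0 ?sqr_ge0// invr_ge0; lra.
Qed.

Lemma expectation_norm_le X : measurable_fun setT X ->
    ('E_P[fun w => (X w ^+ 4)%R] <= A%:E)%E ->
  ('E_P[fun w => `|X w|%R] <= (Num.sqrt (Num.sqrt A))%:E)%E.
Proof.
move=> mX E4; have E2 := expectation_sqr_le mX E4.
set V := Num.sqrt A in E2 *; set b := Num.sqrt V.
have V0 : 0 < V by rewrite sqrtr_gt0.
have b0 : 0 < b by rewrite sqrtr_gt0.
have bb : b ^+ 2 = V by rewrite sqr_sqrtr// ltW.
have -> : b = b / 2 + (2 * b)^-1 * V + 0 * V by rewrite -bb; field; rewrite gt_eqF.
apply: (@expectation_le_affine _ (fun w => X w ^+ 2) (fun w => X w ^+ 2)) => //;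
  do ?[exact: measurable_funX].
- exact: measurableT_comp.
- by move=> w; rewrite sqr_ge0.
- by move=> w; rewrite sqr_ge0.
- lra.
- by rewrite invr_ge0; lra.
- move=> w; rewrite mul0r addr0 -subr_ge0 -(real_normK (num_real (X w))).
  have -> : b / 2 + (2 * b)^-1 * `|X w| ^+ 2 - `|X w| =
      (2 * b)^-1 * (`|X w| - b) ^+ 2 by field; rewrite gt_eqF.
  by rewrite mulr_ge0 ?sqr_ge0// invr_ge0; lra.
Qed.

Lemma Lfun1_fourth_moment X : measurable_fun setT X ->
    ('E_P[fun w => (X w ^+ 4)%R] <= A%:E)%E -> X \in Lfun P 1.
Proof.
move=> mX E4; apply: (dominated_Lfun1 mX _ _ (expectation_norm_le mX E4)) => //.
exact: measurableT_comp.
Qed.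

Lemma norm_expectation_le X : measurable_fun setT X ->
    ('E_P[fun w => (X w ^+ 4)%R] <= A%:E)%E ->
  `|fine 'E_P[X]| <= Num.sqrt (Num.sqrt A).
Proof.
move=> mX E4; rewrite -lee_fin; apply: le_trans (expectation_norm_le mX E4).
have XL := Lfun1_fourth_moment mX E4.
rewrite -abse_EFin fineK ?expectation_fin_num// unlock.
by apply: le_abse_integral => //; exact/measurable_EFinP.
Qed.

Lemma expectation_mul_sqr_le X Z : measurable_fun setT X -> measurable_fun setT Z ->
    ('E_P[fun w => (X w ^+ 4)%R] <= A%:E)%E ->
    ('E_P[fun w => (Z w ^+ 4)%R] <= A%:E)%E ->
  ('E_P[fun w => ((X w * Z w) ^+ 2)%R] <= A%:E)%E.
Proof.
move=> mX mZ EX EZ; have -> : A = 0 + 2^-1 * A + 2^-1 * A by field.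
apply: (@expectation_le_affine _ (fun w => X w ^+ 4) (fun w => Z w ^+ 4)) => //;
  do ?[exact: measurable_funX].
- by apply: measurable_funX; exact: measurable_funM.
- by move=> w; rewrite sqr_ge0.
- by move=> w; rewrite exprn_even_ge0.
- by move=> w; rewrite exprn_even_ge0.
- move=> w; rewrite -subr_ge0.
  have -> : 0 + 2^-1 * X w ^+ 4 + 2^-1 * Z w ^+ 4 - (X w * Z w) ^+ 2 =
      2^-1 * (X w ^+ 2 - Z w ^+ 2) ^+ 2 by field.
  by rewrite mulr_ge0 ?sqr_ge0// invr_ge0.
Qed.

Lemma Lfun1_mul_fourth_moment X Z :
    measurable_fun setT X -> measurable_fun setT Z ->
    ('E_P[fun w => (X w ^+ 4)%R] <= A%:E)%E ->
    ('E_P[fun w => (Z w ^+ 4)%R] <= A%:E)%E ->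
  (fun w => X w * Z w) \in Lfun P 1.
Proof.
move=> mX mZ EX EZ.
apply: (@dominated_Lfun1 _ (fun w => `|X w * Z w|) (1 + 1 * A + 0 * A)) => //.
- exact: measurable_funM.
- by apply: measurableT_comp => //; exact: measurable_funM.
have EXZ := expectation_mul_sqr_le mX mZ EX EZ.
apply: (@expectation_le_affine _ (fun w => (X w * Z w) ^+ 2)
  (fun w => (X w * Z w) ^+ 2)) => //;
  do ?[by apply: measurable_funX; exact: measurable_funM
      |by move=> w; rewrite sqr_ge0].
- by apply: measurableT_comp => //; exact: measurable_funM.
- move=> w; rewrite mul0r addr0 mul1r -(real_normK (num_real (X w * Z w))).
  by have := normr_ge0 (X w * Z w); nra.
Qed.

End fourth_moment.

Lemma expectation_expr4_le X (q K : R) : measurable_fun setT X -> 4 <= q ->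
    ('E_P[fun w => (`|X w| `^ q)%R] <= K%:E)%E ->
  ('E_P[fun w => (X w ^+ 4)%R] <= (K + 1)%:E)%E.
Proof.
move=> mX q4 EX; have -> : K + 1 = 1 + 1 * K + 0 * K by ring.
have mXq : measurable_fun setT (fun w => `|X w| `^ q).
  by apply: (@measurableT_comp _ _ _ _ _ _ (@powR R ^~ q)) => //; exact: measurableT_comp.
apply: (@expectation_le_affine _ (fun w => `|X w| `^ q)
  (fun w => `|X w| `^ q)) => //.
- exact: measurable_funX.
- by move=> w; rewrite exprn_even_ge0.
- by move=> w; rewrite mul0r addr0 mul1r expr4_le_powR.
Qed.

Lemma measurable_norm_gt X (delta : R) : measurable_fun setT X ->
  measurable [set w | delta < `|X w|].
Proof.
move=> mX; have mX' : measurable_fun setT (fun w => `|X w|) by exact: measurableT_comp.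
have /(_ measurableT [set true]) := measurable_fun_ltr (measurable_cst delta) mX'.
by rewrite setTI; exact.
Qed.

Lemma markov_powR X (q K delta : R) : measurable_fun setT X ->
    0 < delta -> 0 <= q ->
    ('E_P[fun w => (`|X w| `^ q)%R] <= K%:E)%E ->
  (P [set w | (delta < `|X w|)%R] <= (K * delta `^ (- q))%:E)%E.
Proof.
move=> mX delta0 q0 EX; rewrite -expectation_indic; last exact: measurable_norm_gt.
have -> : K * delta `^ (- q) = 0 + delta `^ (- q) * K + 0 * K by ring.
have mXq : measurable_fun setT (fun w => `|X w| `^ q).
  by apply: (@measurableT_comp _ _ _ _ _ _ (@powR R ^~ q)) => //; exact: measurableT_comp.
apply: (@expectation_le_affine _ (fun w => `|X w| `^ q)
  (fun w => `|X w| `^ q)) => //; do ?[by move=> w; rewrite powR_ge0].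
- by apply: measurable_indic; exact: measurable_norm_gt.
- exact: powR_ge0.
- move=> w; rewrite mul0r addr0 add0r indicE.
  have [/set_mem/= Xw|_] := boolP (w \in _); last by rewrite mulr_ge0 ?powR_ge0.
  rewrite powRN mulrC ler_pdivlMr ?powR_gt0// mul1r.
  by apply: ge0_ler_powR; rewrite ?nnegrE// ltW.
Qed.

Lemma probability_bigsetU_le (I : finType) (B : I -> set T) (c : R) :
    (forall i, measurable (B i)) -> (forall i, (P (B i) <= c%:E)%E) ->
  (P (\big[setU/set0]_i B i) <= (#|I|%:R * c)%:E)%E.
Proof.
move=> mB PB.
have -> : (#|I|%:R * c)%:E = (\sum_(i : I) c%:E)%E.
  by rewrite sumEFin sumr_const mulr_natl.
have : measurable (\big[setU/set0]_i B i) /\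
    (P (\big[setU/set0]_i B i) <= \sum_(i : I) c%:E)%E.
  apply: (big_ind2 (fun A y => measurable A /\ (P A <= y)%E)) => //.
  - by rewrite measure0.
  - move=> A1 y1 A2 y2 [mA1 P1] [mA2 P2]; split; first exact: measurableU.
    by rewrite (le_trans (measureU2 _ _ _))// leeD.
by case.
Qed.

End moments.

(** * Two-sided deviation bounds and the choice of thresholds *)

Section two_sided.
Context {d d' : measure_display} {T : measurableType d}
  {T' : measurableType d'} {R : realType} {P : probability T R}.

(** The one-sided bound is applied to [g] and to [- g]. Boundedness of the sample stays outside the
    exceptional set, so that one truncation event can serve all coordinates and all pairs. *)
Lemma truncated_deviation n (Y : 'I_n -> {RV P >-> T'}) (g : T' -> R)
    (m v t : R) :
    (0 < n)%N ->
    mutually_independent Y -> measurable_fun setT g -> 0 < v -> 0 <= t ->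
    (forall k, (fun w => g (Y k w)) \in Lfun P 1) ->
    (forall k, 'E_P[fun w => g (Y k w)] = m%:E)%E ->
    (forall k, 'E_P[fun w => (g (Y k w) ^+ 2)%R] <= v%:E)%E ->
  exists B : set T, [/\ measurable B,
    (P B <= (2 * expR (- (n%:R * t ^+ 2 / (3 * v))))%:E)%E &
    forall w, ~ B w -> (forall k, 2 * t / (3 * v) * `|g (Y k w)| <= 1 / 4) ->
      `|n%:R^-1 * \sum_(k < n) g (Y k w) - m| <= t].
Proof.
move=> n0 indY mg v0 t0 L1 Em Ev; set theta := 2 * t / (3 * v).
have theta0 : 0 <= theta by rewrite divr_ge0// mulr_ge0// ltW.
have mNg : measurable_fun setT (fun y => - g y) by exact: measurableT_comp.
pose Bp := truncated_excess Y g theta (n%:R * (m + t)).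
pose Bm := truncated_excess Y (fun y => - g y) theta (n%:R * (- m + t)).
have mBp : measurable Bp by exact: measurable_truncated_excess.
have mBm : measurable Bm by exact: measurable_truncated_excess.
exists (Bp `|` Bm); split; first exact: measurableU.
  rewrite (le_trans (measureU2 _ _ _))// mulrDl mul1r EFinD leeD//.
    exact: truncated_bernstein.
  apply: truncated_bernstein => // k.
  - have -> : (fun w => - g (Y k w)) = (-1) \o* (fun w => g (Y k w)).
      by apply/funext => w /=; rewrite mulrN1.
    by rewrite Lfun_scale.
  - have -> : (fun w => - g (Y k w)) = (-1) \o* (fun w => g (Y k w)).
      by apply/funext => w /=; rewrite mulrN1.
    by rewrite expectationZl// Em -EFinM mulN1r.
  - by under eq_fun do rewrite sqrrN.
move=> w nB small; have nR : 0 < n%:R :> R by rewrite ltr0n.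
have small' k (b : R) : `|b| <= `|g (Y k w)| -> theta * b <= 1 / 4.
  move=> bg; apply: le_trans (small k); rewrite ler_wpM2l//.
  exact: le_trans (ler_norm _) bg.
have sp : \sum_(k < n) g (Y k w) < n%:R * (m + t).
  rewrite ltNge; apply/negP => sge; apply: nB; left; split=> // k.
  exact: small'.
have sm : \sum_(k < n) - g (Y k w) < n%:R * (- m + t).
  rewrite ltNge; apply/negP => sge; apply: nB; right; split=> // k.
  by apply: small'; rewrite normrN.
rewrite sumrN in sm; set S := \sum_(k < n) _ in sp sm *.
have -> : n%:R^-1 * S - m = n%:R^-1 * (S - n%:R * m).
  by field; rewrite gt_eqF.
rewrite normrM gtr0_norm ?invr_gt0// ler_pdivrMl// ler_norml; lra.
Qed.

Lemma expectation_identically_distributed n (Y : 'I_n -> {RV P >-> T'})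
    (g : T' -> R) (k k' : 'I_n) :
    identically_distributed Y -> measurable_fun setT g ->
    (forall k, (fun w => g (Y k w)) \in Lfun P 1) ->
  'E_P[fun w => g (Y k w)]%E = 'E_P[fun w => g (Y k' w)]%E.
Proof.
move=> idY mg L1.
have EY l : 'E_P[fun w => g (Y l w)]%E =
    (\int[distribution P (Y l)]_y (g y)%:E)%E.
  rewrite unlock integral_distribution//; first exact/measurable_EFinP.
  by apply/Lfun1_integrable; exact: L1.
rewrite !EY; apply: eq_measure_integral => B mB _; exact: idY.
Qed.

End two_sided.

(** The product of the two averages is expanded around the product of the means, which leaves one
    quadratic and two linear remainders. *)
Lemma covariance_perturbation (R : realType) (a m b1 b2 mu1 mu2 t s b : R) :
    `|a - m| <= t -> `|b1 - mu1| <= s -> `|b2 - mu2| <= s ->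
    `|mu1| <= b -> `|mu2| <= b ->
  `|(a - b1 * b2) - (m - mu1 * mu2)| <= t + s ^+ 2 + 2 * (b * s).
Proof.
move=> am d1 d2 mub1 mub2.
have -> : (a - b1 * b2) - (m - mu1 * mu2) = (a - m) -
    ((b1 - mu1) * (b2 - mu2) + (mu1 * (b2 - mu2) + mu2 * (b1 - mu1))) by ring.
have q1 : `|(b1 - mu1) * (b2 - mu2)| <= s ^+ 2 by rewrite normrM expr2 ler_pM.
have q2 : `|mu1 * (b2 - mu2)| <= b * s by rewrite normrM ler_pM.
have q3 : `|mu2 * (b1 - mu1)| <= b * s by rewrite normrM ler_pM.
move: am q1 q2 q3; rewrite !ler_norml; lra.
Qed.

Section thresholds.
Context {R : realType} (A M : R) (A1 : 1 <= A) (M0 : 0 < M).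

(* The factor 3 makes the exponent [n t ^+ 2 / (3 v)] of [truncated_deviation]
   equal to [(M + 2) * ln p], resp. [(M + 1) * ln p], for [L = ln p / n]. *)
Definition product_threshold (L : R) := Num.sqrt (3 * A * (M + 2) * L).

Definition mean_threshold (L : R) := Num.sqrt (3 * Num.sqrt A * (M + 1) * L).

Let A0 : 0 < A. Proof. exact: lt_le_trans ltr01 A1. Qed.

Let V0 : 0 < Num.sqrt A. Proof. by rewrite sqrtr_gt0. Qed.

Let V1 : 1 <= Num.sqrt A.
Proof. by rewrite -[leLHS]sqrtr1 ler_wsqrtr. Qed.

Lemma product_threshold_sqr L : 0 <= L ->
  product_threshold L ^+ 2 = 3 * A * (M + 2) * L.
Proof. by move=> L0; rewrite sqr_sqrtr// !mulr_ge0 ?addr_ge0// ltW. Qed.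

Lemma mean_threshold_sqr L : 0 <= L ->
  mean_threshold L ^+ 2 = 3 * Num.sqrt A * (M + 1) * L.
Proof. by move=> L0; rewrite sqr_sqrtr// !mulr_ge0 ?addr_ge0// ltW. Qed.

(** The left side is the error from [covariance_perturbation], with the fourth root of [A] bounding
    the means; the right side is [lambda / 2] when [A = K4 + 1]. *)
Lemma threshold_sum_le L : 0 <= L ->
  product_threshold L + mean_threshold L ^+ 2
    + 2 * (Num.sqrt (Num.sqrt A) * mean_threshold L)
  <= 4 * A * (M + 1) * L + 4 * A * (M + 2) * Num.sqrt L.
Proof.
move=> L0; have := A1; have := M0; have := A0; have := V0; have := V1 => v1 v0 a0 m0 a1.
have VV : Num.sqrt A ^+ 2 = A by rewrite sqr_sqrtr// ltW.
have t0 : 0 <= product_threshold L by exact: sqrtr_ge0.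
have s_le : Num.sqrt (Num.sqrt A) * mean_threshold L <= product_threshold L.
  rewrite /mean_threshold /product_threshold -sqrtrM ?sqrtr_ge0//.
  apply: ler_wsqrtr.
  have -> : Num.sqrt A * (3 * Num.sqrt A * (M + 1) * L) =
      3 * Num.sqrt A ^+ 2 * (M + 1) * L by ring.
  by rewrite VV ler_wpM2r// ler_wpM2l//; lra.
have s2 : mean_threshold L ^+ 2 <= 4 * A * (M + 1) * L.
  rewrite mean_threshold_sqr// ler_wpM2r// ler_wpM2r//; first lra.
  have : Num.sqrt A <= A by rewrite -[leRHS]VV expr2 ler_peMl// ltW//.
  lra.
(* After squaring, this amounts to [27 <= 16 * (A * (M + 2))], which follows from [A >= 1] and
   [M > 0]. *)
suff t_le : 3 * product_threshold L <= 4 * A * (M + 2) * Num.sqrt L by lra.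
have sL0 : 0 <= Num.sqrt L by exact: sqrtr_ge0.
have AM0 : 0 <= A * (M + 2) by apply: mulr_ge0; lra.
rewrite -ler_sqr ?nnegrE; last 2 first.
- by rewrite mulr_ge0.
- by rewrite mulr_ge0// -mulrA mulr_ge0.
rewrite !exprMn product_threshold_sqr// sqr_sqrtr//.
have -> : 4 ^+ 2 * A ^+ 2 * (M + 2) ^+ 2 * L = 16 * (A * (M + 2)) * (A * (M + 2) * L).
  by ring.
have -> : 3 ^+ 2 * (3 * A * (M + 2) * L) = 27 * (A * (M + 2) * L) by ring.
apply: ler_wpM2r; first exact: mulr_ge0.
have : A + A <= A * (M + 2) by nra.
lra.
Qed.

End thresholds.

(** * Deviation of the empirical covariance matrix *)

Section truncation_level.
Context {R : realType}.
Implicit Types A M N lp e : R.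

(** This is N^(1/4) / (log N)^(1/2), written so that its square is immediate. *)
Definition truncation_level N : R := Num.sqrt (Num.sqrt N / ln N).

Lemma truncation_level_sqr N : 1 <= ln N ->
  truncation_level N ^+ 2 = Num.sqrt N / ln N.
Proof.
by move=> l1; rewrite sqr_sqrtr// divr_ge0 ?sqrtr_ge0// (le_trans _ l1).
Qed.

Lemma ln_ge1_gt0 N : 1 <= ln N -> 0 < N.
Proof. by move=> l1; rewrite ltNge; apply/negP => /ln0 lN; move: l1; lra. Qed.

Lemma truncation_level_gt0 N : 1 <= ln N -> 0 < truncation_level N.
Proof.
move=> l1; rewrite sqrtr_gt0 divr_gt0//; last exact: lt_le_trans ltr01 l1.
by rewrite sqrtr_gt0 ln_ge1_gt0.
Qed.

Lemma ln_le_2sqrt N : 0 < N -> ln N <= 2 * Num.sqrt N.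
Proof.
move=> N0; have r0 : 0 < Num.sqrt N by rewrite sqrtr_gt0.
have -> : ln N = 2 * ln (Num.sqrt N).
  by rewrite -{1}(sqr_sqrtr (ltW N0)) lnXn// mulr_natl.
by rewrite ler_wpM2l// ltW// ln_sublinear.
Qed.

(** Products are bounded by the square of the level. In the squared claim [N] cancels, and what
    remains is a multiple of [(M + 2) * lp / ln N ^+ 2], which the last hypothesis controls. *)
Lemma product_truncation A M N lp : 1 <= A -> 0 < M -> 1 <= ln N -> 0 <= lp ->
    64 * (M + 2) * lp <= ln N ^+ 2 ->
  2 * product_threshold A M (lp / N) / (3 * A) * truncation_level N ^+ 2 <= 1 / 4.
Proof.
move=> A1 M0 l1 lp0 lpl; have N0 := ln_ge1_gt0 l1.
have A0 : 0 < A := lt_le_trans ltr01 A1.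
have l0 : 0 < ln N := lt_le_trans ltr01 l1.
rewrite truncation_level_sqr//; set x := _ * _.
suff : x ^+ 2 <= 1 / 16 by nra.
have -> : x ^+ 2 = 4 / 3 * ((M + 2) * lp) / (A * ln N ^+ 2).
  rewrite /x !exprMn product_threshold_sqr ?divr_ge0 ?(ltW N0)//.
  rewrite sqr_sqrtr ?(ltW N0)//; field.
  by rewrite !gt_eqF.
rewrite ler_pdivrMr ?mulr_gt0 ?exprn_gt0//.
have : ln N ^+ 2 <= A * ln N ^+ 2 by rewrite ler_peMl// sqr_ge0.
have := sqr_ge0 (ln N).
lra.
Qed.

(** Single coordinates are bounded by the level itself, which leaves a factor [Num.sqrt N] in the
    denominator; [ln_le_2sqrt] converts it into the missing logarithm. *)
Lemma mean_truncation A M N lp : 1 <= A -> 0 < M -> 1 <= ln N -> 0 <= lp ->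
    64 * (M + 2) * lp <= ln N ^+ 2 ->
  2 * mean_threshold A M (lp / N) / (3 * Num.sqrt A) * truncation_level N <= 1 / 4.
Proof.
move=> A1 M0 l1 lp0 lpl; have N0 := ln_ge1_gt0 l1.
have A0 : 0 < A := lt_le_trans ltr01 A1.
have V0 : 0 < Num.sqrt A by rewrite sqrtr_gt0.
have V1 : 1 <= Num.sqrt A by rewrite -[leLHS]sqrtr1 ler_wsqrtr.
have l0 : 0 < ln N := lt_le_trans ltr01 l1.
have r0 : 0 < Num.sqrt N by rewrite sqrtr_gt0.
set x := _ * _; suff : x ^+ 2 <= 1 / 16 by nra.
have -> : x ^+ 2 = 4 / 3 * ((M + 1) * lp) / (Num.sqrt A * (Num.sqrt N * ln N)).
  rewrite /x !exprMn mean_threshold_sqr ?divr_ge0 ?(ltW N0)//.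
  rewrite truncation_level_sqr// -{1}(sqr_sqrtr (ltW N0)); field.
  by rewrite !gt_eqF.
rewrite ler_pdivrMr ?mulr_gt0//.
have lr := ln_le_2sqrt N0.
have lr2 : ln N ^+ 2 <= 2 * (Num.sqrt N * ln N) by nra.
have rl0 : 0 < Num.sqrt N * ln N by exact: mulr_gt0.
have : Num.sqrt N * ln N <= Num.sqrt A * (Num.sqrt N * ln N) by rewrite ler_peMl// ltW.
have : (M + 1) * lp <= (M + 2) * lp by rewrite ler_wpM2r//; lra.
lra.
Qed.

(** This turns the union bound over the [n * p] Markov tails into the polynomial tail of the
    theorem. Both sides are compared as exponentials of combinations of [ln N] and [ln (ln N)]. *)
Lemma truncation_level_powR N e : 1 <= ln N ->
  N * truncation_level N `^ (- (4 * (1 + e))) =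
  ln N `^ (2 * (1 + e)) * N `^ (- e).
Proof.
move=> l1; have N0 := ln_ge1_gt0 l1.
have l0 : 0 < ln N := lt_le_trans ltr01 l1.
have r0 : 0 < Num.sqrt N by rewrite sqrtr_gt0.
have d0 := truncation_level_gt0 l1.
have lnd : ln (truncation_level N) = 2^-1 * (2^-1 * ln N - ln (ln N)).
  rewrite /truncation_level -powR12_sqrt ?divr_ge0 ?ltW// ln_powR.
  by rewrite ln_div ?posrE// -powR12_sqrt ?ltW// ln_powR.
rewrite /powR !gt_eqF// lnd -{1}(lnK (x := N)) ?posrE// -!expRD.
by congr expR; field.
Qed.

End truncation_level.

Section covariance_deviation.
Context {d d' : measure_display} {T : measurableType d}
  {T' : measurableType d'} {R : realType} {P : probability T R}.

(** Stated for arbitrary coordinate functions [f], so that it serves the lower and the upper bounds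
    alike. *)
Lemma empirical_cov_deviation (n p : nat) (Y : 'I_n -> {RV P >-> T'})
    (f : 'I_p -> T' -> R) (Sigma0 : 'M[R]_p) (K M e : R) :
    (0 < n)%N -> (0 < p)%N -> 0 < K -> 0 < M -> 0 <= e ->
    1 <= ln (n%:R : R) -> 64 * (M + 2) * ln p%:R <= ln n%:R ^+ 2 ->
    iid Y -> (forall j, measurable_fun setT (f j)) ->
    (forall k i j, covariance P (fun w => f i (Y k w)) (fun w => f j (Y k w))
      = (Sigma0 i j)%:E)%E ->
    (forall k j,
      'E_P[fun w => (`|f j (Y k w)| `^ (4 * (1 + e)))%R] <= K%:E)%E ->
  exists B : set T, [/\ measurable B,
    (P B <= (4 * p%:R `^ (- M) +
      K * p%:R * ln n%:R `^ (2 * (1 + e)) * n%:R `^ (- e))%:E)%E &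
    forall w, ~ B w -> forall i j,
      `|empirical_cov (fun k j => f j (Y k w)) i j - Sigma0 i j| <=
      4 * (K + 1) * (M + 1) * (ln p%:R / n%:R)
        + 4 * (K + 1) * (M + 2) * Num.sqrt (ln p%:R / n%:R)].
Proof.
move=> n0 p0 K0 M0 e0 l1 lpl [indY idY] mf covf Kf.
set A := K + 1; set L := ln p%:R / n%:R.
set N : R := n%:R in l1 lpl *; set lp : R := ln p%:R in lpl *.
have N0 : 0 < N by rewrite ltr0n.
have lp0 : 0 <= lp by rewrite ln_ge0// ler1n.
have L0 : 0 <= L by rewrite divr_ge0// ltW.
have A1 : 1 <= A by rewrite lerDr ltW.
have A0 : 0 < A := lt_le_trans ltr01 A1.
have V0 : 0 < Num.sqrt A by rewrite sqrtr_gt0.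
pose X k j w := f j (Y k w).
have mX k j : measurable_fun setT (X k j).
  by apply: (@measurableT_comp _ _ _ _ _ _ (f j) _ (Y k)).
have E4 k j : ('E_P[fun w => (X k j w ^+ 4)%R] <= A%:E)%E.
  by apply: (expectation_expr4_le (mX k j) _ (Kf k j)); lra.
have L1X k j : X k j \in Lfun P 1 := Lfun1_fourth_moment A1 (mX k j) (E4 k j).
have L1XX k i j : (fun w => X k i w * X k j w) \in Lfun P 1.
  exact: Lfun1_mul_fourth_moment (mX k i) (mX k j) (E4 k i) (E4 k j).
pose k0 := Ordinal n0.
pose mu j := fine 'E_P[X k0 j]%E.
pose m2 i j := fine 'E_P[fun w => (X k0 i w * X k0 j w)%R]%E.
have Emu k j : 'E_P[X k j]%E = (mu j)%:E.
  rewrite fineK ?expectation_fin_num//.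
  apply: (expectation_identically_distributed (g := f j)) => // l.
  exact: L1X.
have Em2 k i j : 'E_P[fun w => (X k i w * X k j w)%R]%E = (m2 i j)%:E.
  rewrite fineK ?expectation_fin_num//.
  apply: (expectation_identically_distributed (g := fun y => f i y * f j y)) => //.
    exact: measurable_funM.
  by move=> l; exact: L1XX.
have Sigma0E i j : Sigma0 i j = m2 i j - mu i * mu j.
  apply: EFin_inj; rewrite -(covf k0 i j) covarianceE.
  - by rewrite EFinB EFinM -!(Emu k0) -(Em2 k0).
  - exact: L1X.
  - exact: L1X.
  - exact: L1XX.
pose t := product_threshold A M L; pose s := mean_threshold A M L.
have t0 : 0 <= t by exact: sqrtr_ge0.
have s0 : 0 <= s by exact: sqrtr_ge0.
have /choice[B2 HB2] : forall ij : 'I_p * 'I_p, exists B : set T, [/\ measurable B,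
    (P B <= (2 * expR (- (N * t ^+ 2 / (3 * A))))%:E)%E &
    forall w, ~ B w ->
      (forall k, 2 * t / (3 * A) * `|X k ij.1 w * X k ij.2 w| <= 1 / 4) ->
      `|N^-1 * \sum_(k < n) X k ij.1 w * X k ij.2 w - m2 ij.1 ij.2| <= t].
  move=> [i j] /=.
  apply: (truncated_deviation (g := fun y => f i y * f j y)) => //.
  - exact: measurable_funM.
  - by move=> k; exact: L1XX.
  - by move=> k; exact: Em2.
  - by move=> k; exact: (expectation_mul_sqr_le (mX k i) (mX k j) (E4 k i) (E4 k j)).
have /choice[B1 HB1] : forall j : 'I_p, exists B : set T, [/\ measurable B,
    (P B <= (2 * expR (- (N * s ^+ 2 / (3 * Num.sqrt A))))%:E)%E &
    forall w, ~ B w ->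
      (forall k, 2 * s / (3 * Num.sqrt A) * `|X k j w| <= 1 / 4) ->
      `|N^-1 * \sum_(k < n) X k j w - mu j| <= s].
  move=> j; apply: (truncated_deviation (g := f j)) => //.
  - by move=> k; exact: L1X.
  - by move=> k; exact: Emu.
  - by move=> k; exact: (expectation_sqr_le A1 (mX k j) (E4 k j)).
pose delta := truncation_level N.
have delta0 : 0 < delta by exact: truncation_level_gt0.
(* Failure of truncation, observation by observation: the only exceptional events that produce a
   polynomial tail. *)
pose B0 (kj : 'I_n * 'I_p) := [set w | delta < `|X kj.1 kj.2 w|].
have mB0 kj : measurable (B0 kj) by exact: measurable_norm_gt.
have mB1 j : measurable (B1 j) by case: (HB1 j).
have mB2 ij : measurable (B2 ij) by case: (HB2 ij).
pose U0 := \big[setU/set0]_kj B0 kj.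
pose U1 := \big[setU/set0]_j B1 j.
pose U2 := \big[setU/set0]_ij B2 ij.
have mU0 : measurable U0 by exact: bigsetU_measurable.
have mU1 : measurable U1 by exact: bigsetU_measurable.
have mU2 : measurable U2 by exact: bigsetU_measurable.
exists (U0 `|` U1 `|` U2); split.
- by apply: measurableU => //; exact: measurableU.
- have PU0 : (P U0 <= (K * p%:R * ln N `^ (2 * (1 + e)) * N `^ (- e))%:E)%E.
    have -> : K * p%:R * ln N `^ (2 * (1 + e)) * N `^ (- e) =
        #|{: 'I_n * 'I_p}|%:R * (K * delta `^ (- (4 * (1 + e)))).
      rewrite card_prod !card_ord natrM -!mulrA -truncation_level_powR//.
      by rewrite -/N -/delta; ring.
    apply: probability_bigsetU_le => // -[k j].
    by apply: (markov_powR (mX k j) delta0 _ (Kf k j)); lra.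
  have p0R : 0 < p%:R :> R by rewrite ltr0n.
  have PU1 : (P U1 <= (2 * p%:R `^ (- M))%:E)%E.
    (* The exponent [M + 1] of each event pays for the union over [p] coordinates; below, [M + 2]
       pays for the [p ^ 2] pairs. *)
    have -> : 2 * p%:R `^ (- M) =
        #|'I_p|%:R * (2 * expR (- (N * s ^+ 2 / (3 * Num.sqrt A)))).
      rewrite card_ord mean_threshold_sqr// /powR gt_eqF// -/lp.
      rewrite -(lnK (x := p%:R)) ?posrE// mulrCA -expRD; congr (_ * expR _).
      by rewrite /L -/lp -/N; field; rewrite !gt_eqF.
    by apply: probability_bigsetU_le => // j; case: (HB1 j).
  have PU2 : (P U2 <= (2 * p%:R `^ (- M))%:E)%E.
    have -> : 2 * p%:R `^ (- M) =
        #|{: 'I_p * 'I_p}|%:R * (2 * expR (- (N * t ^+ 2 / (3 * A)))).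
      rewrite card_prod card_ord natrM product_threshold_sqr// /powR gt_eqF// -/lp.
      rewrite -(lnK (x := p%:R)) ?posrE// mulrCA -!expRD; congr (_ * expR _).
      by rewrite /L -/lp -/N; field; rewrite !gt_eqF.
    by apply: probability_bigsetU_le => // j; case: (HB2 j).
  have -> : (4 * p%:R `^ (- M) + K * p%:R * ln N `^ (2 * (1 + e)) * N `^ (- e))%:E
      = ((K * p%:R * ln N `^ (2 * (1 + e)) * N `^ (- e))%:E +
        (2 * p%:R `^ (- M))%:E + (2 * p%:R `^ (- M))%:E)%E.
    by rewrite -!EFinD; congr EFin; ring.
  rewrite (le_trans (measureU2 _ _ _))//; first exact: measurableU.
  by rewrite leeD// (le_trans (measureU2 _ _ _))// leeD.
move=> w nU i j.
have Xdelta k l : `|X k l w| <= delta.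
  rewrite leNgt; apply/negP => dX; apply: nU; left; left.
  by rewrite /U0 -bigcup_seq; exists (k, l) => //=; rewrite mem_index_enum.
have dev2 : `|N^-1 * (\sum_(k < n) X k i w * X k j w) - m2 i j| <= t.
  have [_ _ /(_ w)] := HB2 (i, j); apply.
    move=> B2w; apply: nU; right.
    by rewrite /U2 -bigcup_seq; exists (i, j) => //=; rewrite mem_index_enum.
  move=> k; apply: le_trans (product_truncation A1 M0 l1 lp0 lpl).
  rewrite ler_wpM2l ?divr_ge0 ?mulr_ge0 ?(ltW A0)//= normrM expr2.
  by rewrite ler_pM.
have dev1 l : `|N^-1 * (\sum_(k < n) X k l w) - mu l| <= s.
  have [_ _ /(_ w)] := HB1 l; apply.
    move=> B1w; apply: nU; left; right.
    by rewrite /U1 -bigcup_seq; exists l => //=; rewrite mem_index_enum.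
  move=> k; apply: le_trans (mean_truncation A1 M0 l1 lp0 lpl).
  by rewrite ler_wpM2l ?divr_ge0 ?mulr_ge0 ?(ltW V0).
have mub l : `|mu l| <= Num.sqrt (Num.sqrt A) by exact: norm_expectation_le.
rewrite mxE Sigma0E; apply: le_trans (threshold_sum_le A1 M0 L0).
exact: (covariance_perturbation dev2 (dev1 i) (dev1 j) (mub i) (mub j)).
Qed.

End covariance_deviation.

(** * Growth of the dimension and the final probability bound *)

(** Polynomial growth makes [ln p] at most a constant multiple of [ln n], so the square of [ln n]
    dominates once [ln n] exceeds a fixed constant. *)
Lemma log_dimension_le (R : realType) (gamma c M : R) (n p : nat) :
    0 < gamma -> 0 < c -> 0 < M -> (0 < n)%N -> (0 < p)%N ->
    p%:R <= c * n%:R `^ gamma ->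
    1 + 64 * (M + 2) * (`|ln c| + gamma) <= ln n%:R ->
  64 * (M + 2) * ln p%:R <= ln n%:R ^+ 2.
Proof.
move=> gamma0 c0 M0 n0 p0 pn ln_ge; set l := ln n%:R in ln_ge *.
have b0 : 0 <= `|ln c| + gamma by rewrite addr_ge0// ltW.
have MM : 0 <= 64 * (M + 2) by lra.
have Mb0 := mulr_ge0 MM b0.
have l1 : 1 <= l by lra.
have lp : ln p%:R <= (`|ln c| + gamma) * l.
  have : ln p%:R <= ln (c * n%:R `^ gamma).
    by rewrite ler_ln// posrE ?ltr0n// mulr_gt0// powR_gt0// ltr0n.
  rewrite lnM ?posrE ?powR_gt0 ?ltr0n// ln_powR -/l mulrDl => /le_trans; apply.
  by rewrite lerD2r (le_trans (ler_norm _))// ler_peMr.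
apply: (@le_trans _ _ (64 * (M + 2) * ((`|ln c| + gamma) * l))).
  by rewrite ler_wpM2l.
rewrite mulrA expr2 ler_wpM2r//; lra.
Qed.

Lemma measurable_lower (R : realType) (p : nat) (j : 'I_p) :
  measurable_fun setT (fun y : p.-tuple (R * R)%type => lower y j).
Proof. by apply: measurableT_comp => //; exact: measurable_tnth. Qed.

Lemma measurable_upper (R : realType) (p : nat) (j : 'I_p) :
  measurable_fun setT (fun y : p.-tuple (R * R)%type => upper y j).
Proof. by apply: measurableT_comp => //; exact: measurable_tnth. Qed.

Theorem theorem3p4 (R : realType) (gamma tau K4 c M eps : R)
    (gamma_gt0 : 0 < gamma) (tau_gt0 : 0 < tau) (K4_gt0 : 0 < K4)
    (c_gt0 : 0 < c) (M_gt0 : 0 < M) (eps_gt0 : 0 < eps) :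
  exists C : R,
  forall (n p : nat), (0 < n)%N -> (0 < p)%N ->
    p%:R <= c * n%:R `^ gamma ->
  forall (d : measure_display) (T : measurableType d) (P : probability T R)
    (Y : 'I_n -> {RV P >-> p.-tuple (R * R)%type})
    (Sigma0 : 'M[R]_p) (lambda : R) (Sigma_star : T -> 'M[R]_p),
    (forall k j w, lower (Y k w) j <= upper (Y k w) j) ->
    iid Y ->
    (forall k i j,
      covariance P (fun w => lower (Y k w) i) (fun w => lower (Y k w) j)
        = (Sigma0 i j)%:E /\
      covariance P (fun w => upper (Y k w) i) (fun w => upper (Y k w) j)
        = (Sigma0 i j)%:E) ->
    loewner_ge Sigma0 eps%:M ->
    (forall k j,
      (maxe 'E_P[fun w => (`|lower (Y k w) j| `^ (4 * (1 + gamma + tau)))%R]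
            'E_P[fun w => (`|upper (Y k w) j| `^ (4 * (1 + gamma + tau)))%R]
        <= K4%:E)%E) ->
    lambda = 8 * (K4 + 1) * (M + 1) * (ln p%:R / n%:R)
      + 8 * (K4 + 1) * (M + 2) * Num.sqrt (ln p%:R / n%:R) ->
    (forall w, optimal_solution eps lambda
       (empirical_cov (fun k => lower (Y k w)))
       (empirical_cov (fun k => upper (Y k w))) (Sigma_star w)) ->
    let E := [set w | frobenius_norm (Sigma_star w - Sigma0)
      <= 5 * lambda * Num.sqrt (offdiag_support Sigma0 + p)%:R] in
    measurable E /\
    ((1 - C * p%:R `^ (- M)
      - 6 * K4 * p%:R * ln n%:R `^ (2 * (1 + gamma + tau))
        * n%:R `^ (- (gamma + tau)))%:E <= P E)%E.
Proof.
(* If [ln n < l0], then [p <= q0] and [C * p `^ (- M) >= 1], so the bound is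
   trivial; otherwise [log_dimension_le] makes the truncation level admissible. *)
pose l0 := 1 + 64 * (M + 2) * (`|ln c| + gamma).
pose q0 := c * expR (gamma * l0).
have q0_gt0 : 0 < q0 by rewrite mulr_gt0// expR_gt0.
(* The 8 collects [4 * p ^ (- M)] from each of the two deviation bounds. *)
exists (8 + q0 `^ M) => n p n0 p0 pn d T P Y Sigma0 lambda Sigma_star.
move=> _ iidY covY Sigma0_eps momY lambdaE opt E.
have p0R : 0 < p%:R :> R by rewrite ltr0n.
have lambda0 : 0 <= lambda.
  rewrite lambdaE; have L0 : 0 <= ln p%:R / n%:R :> R.
    by rewrite divr_ge0// ln_ge0// ler1n.
  have KM a : 0 <= a -> 0 <= 8 * (K4 + 1) * (M + a).
    by move=> a0; apply: mulr_ge0; lra.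
  by apply: addr_ge0; apply: mulr_ge0 => //; exact: KM.
have mlower k j : measurable_fun setT (fun w => lower (Y k w) j).
  apply: (@measurableT_comp _ _ _ _ _ _ (fun y => lower y j) _ (Y k)) => //.
  exact: measurable_lower.
have mupper k j : measurable_fun setT (fun w => upper (Y k w) j).
  apply: (@measurableT_comp _ _ _ _ _ _ (fun y => upper y j) _ (Y k)) => //.
  exact: measurable_upper.
have mE : measurable E.
  have mSigma := measurable_optimal_solution lambda0
    (measurable_empirical_cov mlower) (measurable_empirical_cov mupper) opt.
  have mnorm : measurable_fun setT
      (fun w => frobenius_norm (Sigma_star w - Sigma0)).
    apply: measurable_frobenius_norm => i j.
    under eq_fun do rewrite !mxE.
    by apply: measurable_funB => //; exact: mSigma.
  have := measurable_fun_ler mnorm (measurable_cst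
    (5 * lambda * Num.sqrt (offdiag_support Sigma0 + p)%:R)).
  by move=> /(_ measurableT [set true]); rewrite setTI; exact.
split=> //; set tail := 6 * K4 * _ * _ * _.
have tail0 : 0 <= tail by rewrite !mulr_ge0 ?powR_ge0// ltW.
have pM0 : 0 < p%:R `^ (- M) by rewrite powR_gt0.
have [ln_lt|ln_ge] := ltP (ln n%:R) l0.
  have pq0 : p%:R <= q0.
    apply: (le_trans pn); rewrite ler_wpM2l ?(ltW c_gt0)//.
    rewrite /powR pnatr_eq0 gtn_eqF// ler_expR.
    by rewrite ler_wpM2l ?(ltW gamma_gt0)// ltW.
  have : 1 <= q0 `^ M * p%:R `^ (- M).
    rewrite powRN ler_pdivlMr ?powR_gt0// mul1r.
    by rewrite ge0_ler_powR// ?nnegrE ltW.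
  move=> q0M; apply: (@le_trans _ _ 0%E) => //; rewrite lee_fin.
  move: q0M tail0 pM0; rewrite mulrDl; lra.
have lpl := log_dimension_le gamma_gt0 c_gt0 M_gt0 n0 p0 pn ln_ge.
have l1 : 1 <= ln (n%:R : R).
  apply: le_trans ln_ge; rewrite /l0 lerDl !mulr_ge0//; first lra.
  by rewrite addr_ge0// ltW.
have e0 : 0 <= gamma + tau by lra.
have [Bl [mBl PBl devl]] : exists B : set T, [/\ measurable B,
    (P B <= (4 * p%:R `^ (- M) + K4 * p%:R *
      ln n%:R `^ (2 * (1 + (gamma + tau))) * n%:R `^ (- (gamma + tau)))%:E)%E &
    forall w, ~ B w -> forall i j,
      `|empirical_cov (fun k j => lower (Y k w) j) i j - Sigma0 i j| <=
      4 * (K4 + 1) * (M + 1) * (ln p%:R / n%:R)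
        + 4 * (K4 + 1) * (M + 2) * Num.sqrt (ln p%:R / n%:R)].
  apply: (@empirical_cov_deviation _ _ _ _ _ P n p Y (fun j y => lower y j)) => //.
  - exact: measurable_lower.
  - by move=> k i j; case: (covY k i j).
  - by move=> k j; move: (momY k j); rewrite ge_max addrA => /andP[].
have [Bu [mBu PBu devu]] : exists B : set T, [/\ measurable B,
    (P B <= (4 * p%:R `^ (- M) + K4 * p%:R *
      ln n%:R `^ (2 * (1 + (gamma + tau))) * n%:R `^ (- (gamma + tau)))%:E)%E &
    forall w, ~ B w -> forall i j,
      `|empirical_cov (fun k j => upper (Y k w) j) i j - Sigma0 i j| <=
      4 * (K4 + 1) * (M + 1) * (ln p%:R / n%:R)
        + 4 * (K4 + 1) * (M + 2) * Num.sqrt (ln p%:R / n%:R)].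
  apply: (@empirical_cov_deviation _ _ _ _ _ P n p Y (fun j y => upper y j)) => //.
  - exact: measurable_upper.
  - by move=> k i j; case: (covY k i j).
  - by move=> k j; move: (momY k j); rewrite ge_max addrA => /andP[].
have mB : measurable (Bl `|` Bu) by exact: measurableU.
have sub : ~` (Bl `|` Bu) `<=` E.
  move=> w nB.
  (* Each matrix is within [lambda / 2] of [Sigma0] entrywise, hence so is their average. *)
  have close i j : `|2^-1 * (empirical_cov (fun k => lower (Y k w)) i j
      + empirical_cov (fun k => upper (Y k w)) i j) - Sigma0 i j| <= 2^-1 * lambda.
    have := devl w (fun b => nB (or_introl b)) i j.
    have := devu w (fun b => nB (or_intror b)) i j.
    rewrite lambdaE !ler_norml; lra.
  (* The deterministic bound has the factor 2, which is relaxed to 5. *)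
  apply: le_trans (optimal_solution_error lambda0 (opt w) Sigma0_eps close) _.
  by rewrite ler_wpM2r ?sqrtr_ge0// ler_wpM2r//; lra.
apply: (@le_trans _ _ (P (~` (Bl `|` Bu)))); last first.
  by apply: le_measure => //; rewrite inE//; exact: measurableC.
rewrite probability_setC//.
have -> : 1 - (8 + q0 `^ M) * p%:R `^ (- M) - tail =
    1 - ((8 + q0 `^ M) * p%:R `^ (- M) + tail) by ring.
rewrite EFinB leeB//; apply: (le_trans (measureU2 _ _ _)) => //.
apply: (le_trans (leeD PBl PBu)); rewrite -EFinD lee_fin.
have q0M0 : 0 <= q0 `^ M * p%:R `^ (- M) by rewrite mulr_ge0 ?powR_ge0.
rewrite (addrA 1 gamma tau); set z := K4 * _ * _ * _.
have tailE : tail = 6 * z by rewrite /tail /z; ring.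
move: tail0 pM0 q0M0; rewrite tailE; lra.
Qed.
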